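(* (Principle of mathematical induction, a schema.) If $s$ is a natural number and $\Phi(u)$ is a well-formed formula $\Phi$ with natural number $u$ free in $\Phi$, then $$\Phi(0)\wedge\forall u\,(u\notin 0\wedge u\in s\wedge\Phi(u)\rightarrow\Phi(u\cup\{u\}))\rightarrow\Phi(s).$$
   Context: We work in the following first-order theory with one binary relation $\in$; all objects are called sets. Definitions: $s$ is an individual if $s\in s$. $s=t$ means $\forall u(u\in s\leftrightarrow u\in t)$. Axioms: (equality) $\forall s\forall t(s=t\rightarrow\forall u(s\in u\leftrightarrow t\in u))$; (individuals) $\forall s(s\in s\rightarrow\forall u(u\in s\rightarrow u=s))$; (pairs) $\forall s\forall t\exists v\forall u(u\in v\leftrightarrow(u=s\vee u=t))$, $v$ denoted $\{s,t\}$, and $\{s\}=\{s,s\}$; (regularity) $\forall s\exists v\,[(v\in s\wedge v\in v\wedge\forall u(u\in s\rightarrow u\in u))\vee(v\in s\wedge v\notin v\wedge\forall u(u\in v\wedge u\notin u\rightarrow u\notin s))]$; (union) $\forall s\exists v\forall u(u\in v\leftrightarrow\exists w(w\in s\wedge u\in w))$, $v$ denoted $\bigcup s$, and $s\cup t=\bigcup\{s,t\}$; (power) $\forall s\exists v\forall u(u\in v\leftrightarrow\forall w(w\in u\rightarrow w\in s))$; (separation) for every formula $\Phi(u)$ with $u$ free: $\forall s(\exists u(u\in s\wedge\Phi(u))\rightarrow\exists v\forall u(u\in v\leftrightarrow u\in s\wedge\Phi(u)))$. (In particular every set has a member; there is no empty set.) $s\subseteq t$ means $\forall u(u\in s\rightarrow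 u\in t)$. $s$ is transitive if $\forall u(u\in s\rightarrow u\subseteq s)$; in the phrase ''transitive set'' the set is not an individual, whereas ''transitive members'' may be individuals. A pair of different individuals $o\neq e$ is fixed and $0=\{o,e\}$. $s$ is a natural number if $s$ is a transitive set with transitive members and $s\notin 0\wedge\forall u(u\in s\cup\{s\}\rightarrow u\in 0\cup\{0\}\vee\bigcup u\in u)$. Its successor is $s\cup\{s\}$. *)

(* Defs.v *)
From Stdlib Require Import Arith ClassicalEpsilon.

(* First-order structures for the language with the single binary relation
   symbol [∈].  The symbol [=] is not part of the language: it abbreviates
   coextensionality [≡], which need not be Leibniz equality of the carrier. *)
Record structure : Type := Structure {
  carrier :> Type;
  mem : carrier -> carrier -> Prop
}.

Declare Scope sets_scope.
Open Scope sets_scope.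

Notation "s ∈ t" := (mem _ s t) (at level 70, no associativity) : sets_scope.
Notation "s ∉ t" := (~ mem _ s t) (at level 70, no associativity) : sets_scope.

Definition individual {S : structure} (s : S) : Prop := s ∈ s.

Definition set_eq {S : structure} (s t : S) : Prop :=
  forall u : S, u ∈ s <-> u ∈ t.

Notation "s ≡ t" := (set_eq s t) (at level 70, no associativity) : sets_scope.

Definition subset {S : structure} (s t : S) : Prop :=
  forall u : S, u ∈ s -> u ∈ t.

Notation "s ⊆ t" := (subset s t) (at level 70, no associativity) : sets_scope.

(* Formulas have variables [0, 1, 2, ...], bound by name. *)
Inductive formula : Type :=
| Mem : nat -> nat -> formula
| Neg : formula -> formula
| Conj : formula -> formula -> formula
| Disj : formula -> formula -> formula
| Impl : formula -> formula -> formula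
| Equiv : formula -> formula -> formula
| Forall : nat -> formula -> formula
| Exists : nat -> formula -> formula.

Definition update {A : Type} (rho : nat -> A) (x : nat) (a : A) : nat -> A :=
  fun y => if Nat.eqb y x then a else rho y.

Fixpoint sat {S : structure} (rho : nat -> S) (Phi : formula) : Prop :=
  match Phi with
  | Mem x y => rho x ∈ rho y
  | Neg A => ~ sat rho A
  | Conj A B => sat rho A /\ sat rho B
  | Disj A B => sat rho A \/ sat rho B
  | Impl A B => sat rho A -> sat rho B
  | Equiv A B => sat rho A <-> sat rho B
  | Forall x A => forall a : S, sat (update rho x a) A
  | Exists x A => exists a : S, sat (update rho x a) A
  end.

(* [holds Phi x rho u] is Phi(u), where u is the value of the variable x and
   rho gives the values of the other free variables (the parameters). *)
Definition holds {S : structure} (Phi : formula) (x : nat) (rho : nat -> S)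
    (u : S) : Prop :=
  sat (update rho x u) Phi.

Record set_axioms (S : structure) : Prop := SetAxioms {
  ax_equality : forall s t : S, s ≡ t -> forall u : S, s ∈ u <-> t ∈ u;
  ax_individuals : forall s : S, s ∈ s -> forall u : S, u ∈ s -> u ≡ s;
  ax_pairs : forall s t : S, exists v : S, forall u : S,
    u ∈ v <-> (u ≡ s \/ u ≡ t);
  ax_regularity : forall s : S, exists v : S,
    (v ∈ s /\ v ∈ v /\ forall u : S, u ∈ s -> u ∈ u) \/
    (v ∈ s /\ v ∉ v /\ forall u : S, u ∈ v /\ u ∉ u -> u ∉ s);
  ax_union : forall s : S, exists v : S, forall u : S,
    u ∈ v <-> exists w : S, w ∈ s /\ u ∈ w;
  ax_power : forall s : S, exists v : S, forall u : S,
    u ∈ v <-> forall w : S, w ∈ u -> w ∈ s;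
  ax_separation : forall (Phi : formula) (x : nat) (rho : nat -> S) (s : S),
    (exists u : S, u ∈ s /\ holds Phi x rho u) ->
    exists v : S, forall u : S, u ∈ v <-> u ∈ s /\ holds Phi x rho u
}.

Record model : Type := Model {
  model_structure :> structure;
  model_axioms : set_axioms model_structure
}.

(* The defining conditions of pairs and unions determine them up to [≡], and
   formulas cannot distinguish coextensional sets, so it is immaterial which
   witness of the axiom is selected. *)
Definition upair {M : model} (s t : M) : M :=
  proj1_sig (constructive_indefinite_description _
    (ax_pairs _ (model_axioms M) s t)).

Definition singleton {M : model} (s : M) : M := upair s s.

Definition bigcup {M : model} (s : M) : M :=
  proj1_sig (constructive_indefinite_description _
    (ax_union _ (model_axioms M) s)).

Definition cup {M : model} (s t : M) : M := bigcup (upair s t).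

Notation "s ∪ t" := (cup s t) (at level 50, left associativity) : sets_scope.

Definition transitive {S : structure} (s : S) : Prop :=
  forall u : S, u ∈ s -> u ⊆ s.

Definition transitive_set {S : structure} (s : S) : Prop :=
  ~ individual s /\ transitive s.

Definition zero {M : model} (o e : M) : M := upair o e.

Definition succ {M : model} (s : M) : M := s ∪ singleton s.

Definition natural_number {M : model} (o e s : M) : Prop :=
  transitive_set s /\ (forall u : M, u ∈ s -> transitive u) /\
  s ∉ zero o e /\
  forall u : M, u ∈ s ∪ singleton s ->
    u ∈ zero o e ∪ singleton (zero o e) \/ bigcup u ∈ u.

(* Main.v *)
(* Regularity gives ∈-induction along non-individuals inside a transitive set.
   A non-individual v of s ∪ {s} different from 0 has w = ⋃v as a member, and w
   is again a non-individual.  Two ∈-inductions show that all non-individuals of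
   s ∪ {s} have exactly the individuals o and e as individual members, and that
   they are linearly ordered by ∈.  Hence v = w ∪ {w}, since w ∈ u ∈ v would
   give w ∈ ⋃v = w; so a third ∈-induction proves Φ on all non-individuals of
   s ∪ {s}. *)

From Stdlib Require Import PeanoNat Classical ClassicalEpsilon.
Require Import Defs.

Lemma set_eq_refl {S : structure} (s : S) : s ≡ s.
Proof. intro u; tauto. Qed.

Lemma set_eq_sym {S : structure} (s t : S) : s ≡ t -> t ≡ s.
Proof. intros H u; specialize (H u); tauto. Qed.

Lemma mem_congr_l {M : model} (s t u : M) : s ≡ t -> s ∈ u -> t ∈ u.
Proof. intros H; apply (ax_equality _ (model_axioms M) s t H u). Qed.

Lemma individual_congr {M : model} (s t : M) :
  s ≡ t -> individual s -> individual t.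
Proof. intros H Hs; apply H; exact (mem_congr_l s t s H Hs). Qed.

(** Formulas respect [≡] because the atomic case does: the equality axiom handles the left side of
    [∈], the definition of [≡] the right side. *)
Lemma sat_congr {M : model} (Phi : formula) : forall rho sigma : nat -> M,
  (forall n, rho n ≡ sigma n) -> sat rho Phi <-> sat sigma Phi.
Proof.
  assert (Hup : forall (rho sigma : nat -> M) x a,
    (forall n, rho n ≡ sigma n) ->
    forall n, update rho x a n ≡ update sigma x a n).
  { intros rho sigma x a H n; unfold update.
    destruct (Nat.eqb n x); [apply set_eq_refl | apply H]. }
  induction Phi as [m n|A IA|A IA B IB|A IA B IB|A IA B IB|A IA B IB|x A IA|x A IA];
    intros rho sigma H; simpl.
  - rewrite <- (H n (sigma m)).
    exact (ax_equality _ (model_axioms M) _ _ (H m) (rho n)).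
  - rewrite (IA _ _ H); tauto.
  - rewrite (IA _ _ H), (IB _ _ H); tauto.
  - rewrite (IA _ _ H), (IB _ _ H); tauto.
  - rewrite (IA _ _ H), (IB _ _ H); tauto.
  - rewrite (IA _ _ H), (IB _ _ H); tauto.
  - split; intros K a; apply (IA _ _ (Hup _ _ x a H)); apply K.
  - split; intros [a K]; exists a; apply (IA _ _ (Hup _ _ x a H)); exact K.
Qed.

Lemma holds_congr {M : model} (Phi : formula) (x : nat) (rho : nat -> M)
    (s t : M) : s ≡ t -> holds Phi x rho s -> holds Phi x rho t.
Proof.
  intros H; refine (proj1 (sat_congr Phi _ _ _)); intro n; unfold update.
  destruct (Nat.eqb n x); [exact H | apply set_eq_refl].
Qed.

Lemma mem_upair {M : model} (s t u : M) : u ∈ upair s t <-> u ≡ s \/ u ≡ t.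
Proof.
  unfold upair; destruct (constructive_indefinite_description _ _) as [v Hv].
  apply Hv.
Qed.

Lemma mem_bigcup {M : model} (s u : M) :
  u ∈ bigcup s <-> exists w : M, w ∈ s /\ u ∈ w.
Proof.
  unfold bigcup; destruct (constructive_indefinite_description _ _) as [v Hv].
  apply Hv.
Qed.

Lemma mem_succ {M : model} (s u : M) : u ∈ succ s <-> u ∈ s \/ u ≡ s.
Proof.
  unfold succ, cup; rewrite mem_bigcup; split.
  - intros [w [Hw Hu]]; apply mem_upair in Hw as [Hw|Hw]; apply Hw in Hu.
    + tauto.
    + apply mem_upair in Hu; tauto.
  - intros [Hu|Hu].
    + exists s; split; [apply mem_upair; left; apply set_eq_refl | exact Hu].
    + exists (singleton s); split; apply mem_upair; [right; apply set_eq_refl|].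
      left; exact Hu.
Qed.

Lemma mem_zero_individual {M : model} (o e u : M) :
  individual o -> individual e -> u ∈ zero o e -> individual u.
Proof.
  intros Ho He Hu; apply mem_upair in Hu as [H|H];
    apply set_eq_sym in H; eapply individual_congr; eauto.
Qed.

Lemma inhabited_set {M : model} (s : M) : exists u : M, u ∈ s.
Proof.
  destruct (ax_regularity _ (model_axioms M) s) as [v [H|H]]; exists v; tauto.
Qed.

(** Every set has a member, so [w ∈ a]; and an individual has only itself as a member. *)
Lemma set_eq_individual {M : model} (a w : M) :
  individual w -> (forall u : M, u ∈ a -> u ≡ w) -> a ≡ w.
Proof.
  intros Hw Ha.
  assert (wa : w ∈ a).
  { destruct (inhabited_set a) as [y Hy]; exact (mem_congr_l _ _ _ (Ha y Hy) Hy). }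
  intro z; split; intro Hz.
  - exact (mem_congr_l _ _ _ (set_eq_sym _ _ (Ha z Hz)) Hw).
  - apply (mem_congr_l w); [|exact wa].
    exact (set_eq_sym _ _ (ax_individuals _ (model_axioms M) w Hw z Hz)).
Qed.

(** If [bigcup v] is an individual [w], all members of members of [v] equal [w]; hence each member
    of [v] collapses to [w], and then so does [v]. *)
Lemma bigcup_not_individual {M : model} (v : M) :
  ~ individual v -> ~ individual (bigcup v).
Proof.
  intros Hv Hw; apply Hv.
  apply (individual_congr (bigcup v)); [|exact Hw].
  apply set_eq_sym, set_eq_individual; [exact Hw|].
  intros u Hu; apply set_eq_individual; [exact Hw|].
  intros y Hy; apply (ax_individuals _ (model_axioms M) _ Hw).
  apply mem_bigcup; exists u; split; assumption.
Qed.

(** Regularity, applied to the set of non-individual counterexamples, yields a minimal one.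
    Separation forms that set, which is why the property has to be a formula. *)
Lemma mem_induction {M : model} (t : M) (Phi : formula) (x : nat)
    (rho : nat -> M) :
  transitive t ->
  (forall v : M, v ∈ t -> ~ individual v ->
     (forall u : M, u ∈ v -> ~ individual u -> holds Phi x rho u) ->
     holds Phi x rho v) ->
  forall v : M, v ∈ t -> ~ individual v -> holds Phi x rho v.
Proof.
  intros Ht IH v Hv Iv; apply NNPP; intro HP.
  pose (Psi := Conj (Neg (Mem x x)) (Neg Phi)).
  assert (HPsi : forall u : M,
    holds Psi x rho u <-> ~ individual u /\ ~ holds Phi x rho u).
  { intro u; unfold holds, Psi, individual; simpl.
    unfold update at 1 2; rewrite Nat.eqb_refl; tauto. }
  destruct (ax_separation _ (model_axioms M) Psi x rho t) as [a Ha].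
  { exists v; rewrite HPsi; tauto. }
  destruct (ax_regularity _ (model_axioms M) a) as [m [[Hm [_ K]]|[Hm [Im K]]]].
  (* Here regularity makes all counterexamples individuals, which [v] is not. *)
  - apply Iv, K, Ha; rewrite HPsi; tauto.
  - apply Ha in Hm as [Hmt Hm]; apply HPsi in Hm as [_ Hm].
    apply Hm, IH; [exact Hmt | exact Im |].
    intros u Hu Iu; apply NNPP; intro HPu; apply (K u); [split; assumption|].
    apply Ha; rewrite HPsi; split; [exact (Ht m Hmt u Hu) | tauto].
Qed.

Lemma natural_succ_mem_transitive {M : model} (o e s u : M) :
  natural_number o e s -> u ∈ succ s -> transitive u.
Proof.
  intros [[_ Hs] [Hm _]] Hu; apply mem_succ in Hu as [Hu|Hu]; [exact (Hm u Hu)|].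
  intros a Ha b Hb; apply Hu; apply Hu in Ha; exact (Hs a Ha b Hb).
Qed.

Lemma natural_succ_transitive {M : model} (o e s : M) :
  natural_number o e s -> transitive (succ s).
Proof.
  intros [[_ Hs] _] u Hu a Ha; apply mem_succ; left.
  apply mem_succ in Hu as [Hu|Hu]; [exact (Hs u Hu a Ha) | apply Hu, Ha].
Qed.

(** Members of [zero o e] are individuals, so the first alternative of the definition leaves only
    [zero o e] itself. *)
Lemma natural_succ_mem_cases {M : model} (o e s u : M) :
  individual o -> individual e -> natural_number o e s ->
  u ∈ succ s -> ~ individual u ->
  u ≡ zero o e \/ bigcup u ∈ u.
Proof.
  intros Ho He [_ [_ [_ H]]] Hu Iu; destruct (H u Hu) as [K|K]; [|tauto].
  apply mem_succ in K as [K|K]; [|tauto].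
  destruct (Iu (mem_zero_individual o e u Ho He K)).
Qed.

(** Passing from [v] to [bigcup v] preserves the individual members, so the claim descends to
    [zero o e]. *)
Lemma natural_succ_individuals {M : model} (o e s v : M) :
  individual o -> individual e -> natural_number o e s ->
  v ∈ succ s -> ~ individual v ->
  forall i : M, individual i -> i ∈ v <-> i ∈ zero o e.
Proof.
  intros Ho He Hs.
  (* Variable 0 is [v], 2 is the individual, and 1 gets [zero o e] from the constant assignment. *)
  pose (Phi := Forall 2 (Impl (Mem 2 2) (Equiv (Mem 2 0) (Mem 2 1)))).
  revert v.
  apply (mem_induction (succ s) Phi 0 (fun _ => zero o e)
    (natural_succ_transitive o e s Hs)).
  intros v Hv Iv IH i Hi; simpl in *.
  destruct (natural_succ_mem_cases o e s v Ho He Hs Hv Iv) as [K|K]; [apply K|].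
  pose proof (IH _ K (bigcup_not_individual v Iv) i Hi) as IHi.
  simpl in IHi; unfold update in *; simpl in *; rewrite <- IHi, mem_bigcup.
  split.
  (* An individual is its own witness: [i ∈ i] and [i ∈ v]. *)
  - intro Hiv; exists i; split; assumption.
  - intros [w [Hw Hiw]].
    exact (natural_succ_mem_transitive o e s v Hs Hv w Hw i Hiw).
Qed.

Lemma natural_succ_trichotomy {M : model} (o e s a b : M) :
  individual o -> individual e -> natural_number o e s ->
  a ∈ succ s -> ~ individual a -> b ∈ succ s -> ~ individual b ->
  b ∈ a \/ b ≡ a \/ a ∈ b.
Proof.
  intros Ho He Hs Ha Ia; revert a Ha Ia b.
  pose proof (natural_succ_transitive o e s Hs) as Ts.
  (* Variables 0 and 1 stand for [a] and [b]; 3 takes the constant value [succ s]. *)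
  pose (Comp := Disj (Mem 1 0)
    (Disj (Forall 2 (Equiv (Mem 2 1) (Mem 2 0))) (Mem 0 1))).
  pose (Phi := Forall 1 (Impl (Mem 1 3) (Impl (Neg (Mem 1 1)) Comp))).
  apply (mem_induction (succ s) Phi 0 (fun _ => succ s) Ts).
  intros a Ha Ia IHa.
  change (forall b : M, b ∈ succ s -> ~ individual b ->
    b ∈ a \/ b ≡ a \/ a ∈ b).
  (* With [a] fixed, the constant assignment supplies it as variable 0. *)
  apply (mem_induction (succ s) Comp 1 (fun _ => a) Ts).
  intros b Hb Ib IHb.
  change (b ∈ a \/ b ≡ a \/ a ∈ b).
  (* If [a] and [b] are incomparable, they have the same members; [N] stays available to refute the
     other cases. *)
  apply NNPP; intro N; apply N; right; left.
  pose proof (natural_succ_individuals o e s a Ho He Hs Ha Ia) as Ja.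
  pose proof (natural_succ_individuals o e s b Ho He Hs Hb Ib) as Jb.
  intro u; destruct (classic (individual u)) as [Iu|Iu].
  { rewrite (Ja u Iu), (Jb u Iu); tauto. }
  split; intro Hu.
  (* The inner hypothesis compares [u ∈ b] with [a]: anything but [u ∈ a] forces [a ∈ b]. *)
  - assert (C : u ∈ a \/ u ≡ a \/ a ∈ u) by exact (IHb u Hu Iu).
    destruct C as [C|[C|C]]; [exact C | |]; exfalso; apply N; right; right.
    + exact (mem_congr_l u a b C Hu).
    + exact (natural_succ_mem_transitive o e s b Hs Hb u Hu a C).
  (* The outer hypothesis compares [b] with [u ∈ a]: anything but [u ∈ b] forces [b ∈ a]. *)
  - assert (C : b ∈ u \/ b ≡ u \/ u ∈ b) by exact (IHa u Hu Iu b Hb Ib).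
    destruct C as [C|[C|C]]; [| |exact C]; exfalso; apply N; left.
    + exact (natural_succ_mem_transitive o e s a Hs Ha u Hu b C).
    + exact (mem_congr_l u b a (set_eq_sym _ _ C) Hu).
Qed.

(** Trichotomy against [bigcup v] places the non-individual members of [v]; individual ones are
    members of themselves, hence of the union. *)
Lemma natural_succ_bigcup {M : model} (o e s v : M) :
  individual o -> individual e -> natural_number o e s ->
  v ∈ succ s -> ~ individual v -> bigcup v ∈ v -> succ (bigcup v) ≡ v.
Proof.
  intros Ho He Hs Hv Iv Hw u.
  pose proof (bigcup_not_individual v Iv) as Iw.
  pose proof (natural_succ_transitive o e s Hs v Hv) as Sv.
  rewrite mem_succ; split.
  - intros [Hu|Hu].
    + exact (natural_succ_mem_transitive o e s v Hs Hv _ Hw u Hu).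
    + exact (mem_congr_l _ _ _ (set_eq_sym _ _ Hu) Hw).
  - intro Hu; destruct (classic (individual u)) as [Iu|Iu].
    + left; apply mem_bigcup; exists u; split; assumption.
    + destruct (natural_succ_trichotomy o e s (bigcup v) u Ho He Hs
        (Sv _ Hw) Iw (Sv _ Hu) Iu) as [C|[C|C]]; [tauto | tauto |].
      destruct Iw; apply mem_bigcup; exists u; split; assumption.
Qed.

Theorem theorem5 (M : model) (o e : M)
    (ho : individual o) (he : individual e) (hoe : ~ o ≡ e)
    (s : M) (hs : natural_number o e s)
    (Phi : formula) (x : nat) (rho : nat -> M) :
  holds Phi x rho (zero o e) /\
  (forall u : M, u ∉ zero o e /\ u ∈ s /\ holds Phi x rho u ->
     holds Phi x rho (u ∪ singleton u)) ->
  holds Phi x rho s.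
Proof.
  intros [H0 HS].
  (* The induction runs over [succ s] so that [s] itself is reached. *)
  apply (mem_induction (succ s) Phi x rho (natural_succ_transitive o e s hs)).
  - intros v Hv Iv IH.
    destruct (natural_succ_mem_cases o e s v ho he hs Hv Iv) as [K|K].
    + exact (holds_congr _ _ _ _ _ (set_eq_sym _ _ K) H0).
    + pose proof (bigcup_not_individual v Iv) as Iw.
      apply (holds_congr _ _ _ (succ (bigcup v))).
      { exact (natural_succ_bigcup o e s v ho he hs Hv Iv K). }
      apply HS; split; [|split].
      * intro Z; exact (Iw (mem_zero_individual o e _ ho he Z)).
      (* The step hypothesis is restricted to members of [s]: [bigcup v ∈ s] holds by transitivity
         when [v ∈ s], directly when [v ≡ s]. *)
      * destruct hs as [[_ Ts] _].
        apply mem_succ in Hv as [Hv|Hv]; [exact (Ts v Hv _ K) | apply Hv, K].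
      * exact (IH _ K Iw).
  - apply mem_succ; right; apply set_eq_refl.
  - apply hs.
Qed.
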